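(* Let $G$ be a graph and let $\delta\in\mathbb{R}^{+}$. Let $L$ be an upper bound on the length of paths in $G$. Let $\delta^\star=\frac{a^\star}{b^\star}\ge\delta$ be the minimal rational among those with positive integers $a^\star\le 2L+2$ and $b^\star\in\mathbb{N}$. Then $\mathrm{disp}_{\delta}(G)=\mathrm{disp}_{\delta^\star}(G)$.
   Context: Graphs are finite, undirected, connected, without loops and without isolated vertices. Every edge is a unit-length segment. $P(G)$ is the set of all points on all edges and vertices of $G$. For $p,q\in P(G)$, $d(p,q)$ is the length of a shortest path between $p$ and $q$ in this metric space. For a real $\delta>0$, a set $S\subseteq P(G)$ is $\delta$-dispersed if $d(p,q)\ge\delta$ for all distinct $p,q\in S$. $\mathrm{disp}_\delta(G)$ denotes the maximum size of a $\delta$-dispersed set of $G$. The length of a path in $G$ is its number of edges. Paths are not required to be induced, so $L$ bounds the number of edges of every path (as a subgraph) in $G$. *)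

(* Defs.v *)
From HB Require Import structures.
From mathcomp Require Import all_boot all_order all_algebra.
From mathcomp Require Import all_classical all_reals.
From mathcomp Require Import lra.
Set Implicit Arguments.
Unset Strict Implicit.
Unset Printing Implicit Defensive.
Import Order.TTheory GRing.Theory Num.Theory.
Local Open Scope classical_set_scope.
Local Open Scope card_scope.
Local Open Scope ring_scope.

(* Simple graphs; the empty graph is not excluded. *)
Definition is_graph (V : finType) (e : rel V) : Prop :=
  [/\ symmetric e, irreflexive e, forall u v : V, connect e u v
    & forall u : V, exists v : V, e u v].

Definition path_length_bound (V : finType) (e : rel V) (L : nat) : Prop :=
  forall (u : V) (s : seq V), path e u s -> uniq (u :: s) -> (size s <= L)%N.

Section Dispersion.
Context {R : realType} {V : finType}.
Implicit Types (e : rel V) (u v : V) (p q : {ffun V -> R}) (s t d l : R).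

(* The point of the edge uv at distance t from u, in barycentric coordinates:
   this makes edgept u v t = edgept v u (1 - t), edgept u v 0 = edgept u w 0,
   and no other identification (for u != v). *)
Definition edgept u v t : {ffun V -> R} :=
  [ffun w => (1 - t) *+ (w == u) + t *+ (w == v)].

Definition points e : set {ffun V -> R} :=
  [set p | exists u v t, [/\ e u v, 0 <= t <= 1 & p = edgept u v t]].

(* [route e p q l]: some path from p to q, made of finitely many straight
   pieces each contained in a single edge, has length l. *)
Inductive route e : {ffun V -> R} -> {ffun V -> R} -> R -> Prop :=
| route_refl p : points e p -> route e p p 0
| route_step u v s t q l :
    e u v -> 0 <= s <= 1 -> 0 <= t <= 1 -> route e (edgept u v t) q l ->
    route e (edgept u v s) q (`|s - t| + l).

Definition dist e p q : R := inf [set l | route e p q l].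

Definition dispersed e d (S : set {ffun V -> R}) : Prop :=
  S `<=` points e /\ forall p q, S p -> S q -> p <> q -> d <= dist e p q.

Definition dispersed_size e d (n : nat) : Prop :=
  exists2 S : set {ffun V -> R}, dispersed e d S & S #= `I_n.

(* The default value 0 is never used when 0 < d: see dispP. *)
Definition disp e d : nat :=
  xget 0%N [set n | dispersed_size e d n /\
                    forall m, dispersed_size e d m -> (m <= n)%N].

Definition rounding_candidate (L : nat) d : set R :=
  [set s | exists a b : nat,
     [/\ (0 < a <= 2 * L + 2)%N, (0 < b)%N, s = a%:R / b%:R & d <= s]].

Definition rounding (L : nat) d s : Prop :=
  rounding_candidate L d s /\
  forall s', rounding_candidate L d s' -> s <= s'.

Lemma route_ge0 e p q l : route e p q l -> 0 <= l.
Proof. by elim=> // *; rewrite addr_ge0. Qed.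

Lemma dist_edge e u v s t : e u v -> 0 <= s <= 1 -> 0 <= t <= 1 ->
  dist e (edgept u v s) (edgept u v t) <= `|s - t|.
Proof.
move=> euv hs ht; rewrite -[leRHS]addr0; apply: ge_inf.
  by exists 0 => l /route_ge0.
by apply: route_step => //; apply: route_refl; exists u, v, t.
Qed.

Lemma dispersed_card_le e d (S : set {ffun V -> R}) : 0 < d -> dispersed e d S ->
  S #<= `I_(#|{: V * V * 'I_(Num.truncn d^-1).+2}|).
Proof.
move=> d0 [Spt Sd]; set N := (Num.truncn d^-1).+1.
have N0 : 0 < N%:R :> R by rewrite ltr0n.
have dN : N%:R^-1 < d.
  by rewrite invf_plt ?posrE// /N real_truncnS_gt ?num_real.
have [[p0 Sp0]|nS] := pselect (S !=set0); last first.
  by move/nonemptyPn: nS => ->; exact: card_ge0.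
have [u0 [_ _]] := Spt _ Sp0.
have H p : exists x : V * V * R, S p ->
    [/\ e x.1.1 x.1.2, 0 <= x.2 <= 1 & p = edgept x.1.1 x.1.2 x.2].
  have [Sp|nSp] := pselect (S p); last by exists (u0, u0, 0).
  by have [u [v [t [*]]]] := Spt _ Sp; exists (u, v, t).
have [f fP] := choice H.
pose cell (t : R) : 'I_N.+1 := inord (Num.truncn (t * N%:R)).
have cellP t : 0 <= t <= 1 -> (cell t)%:R <= t * N%:R < (cell t).+1%:R.
  case/andP=> t0 t1; rewrite inordK; first by rewrite truncn_itv ?mulr_ge0.
  by rewrite truncn_lt_nat ?mulr_ge0// (@le_lt_trans _ _ N%:R) ?ltr_nat// ler_piMl.
pose g p : V * V * 'I_N.+1 := ((f p).1, cell (f p).2).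
have gI : {in S &, injective g}.
  move=> p q; rewrite !inE => Sp Sq [guv gt].
  have [ep tp pE] := fP _ Sp; have [eq tq qE] := fP _ Sq.
  apply: contrapT => pq; have := Sd _ _ Sp Sq pq; apply/negP; rewrite -ltNge.
  apply: le_lt_trans dN; rewrite {1}pE {1}qE -guv.
  apply: (le_trans (dist_edge ep tp tq)).
  rewrite -[leRHS]mul1r ler_pdivlMr// -[X in _ * X]gtr0_norm// -normrM mulrBl.
  have /andP[a1 b1] := cellP _ tp; have /andP[a2 b2] := cellP _ tq.
  move: a2 b2; rewrite -gt => a2 b2; rewrite ler_distl.
  move: a1 b1 a2 b2; set c := nat_of_ord _; rewrite -(natr1 c).
  by move: c%:R (_ * _) (_ * _) => c' x y *; apply/andP; split; lra.
have /card_eqPle[_ SgS] := inj_card_eq gI; apply: card_le_trans SgS _.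
apply: card_le_trans (subset_card_le (@subsetT _ _)) _.
pose h (x : V * V * 'I_N.+1) : nat := enum_rank x.
have /card_eqPle[_ hT] : h @` setT #= [set: V * V * 'I_N.+1].
  by apply: inj_card_eq => x y _ _ /val_inj/enum_rank_inj.
apply: card_le_trans hT (subset_card_le _) => _ [x _ <-].
exact: ltn_ord.
Qed.

(* disp is really a maximum, over finite and infinite dispersed sets alike. *)
Lemma dispP e d : 0 < d ->
  (exists2 S : set {ffun V -> R}, dispersed e d S & S #= `I_(disp e d)) /\
  (forall S : set {ffun V -> R}, dispersed e d S -> S #<= `I_(disp e d)).
Proof.
move=> d0; pose K := #|{: V * V * 'I_(Num.truncn d^-1).+2}|.
have bnd m : `[< dispersed_size e d m >] -> (m <= K)%N.
  move=> /asboolP[S /(dispersed_card_le d0) SK Sm].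
  by rewrite -card_le_II; case/card_eqPle: Sm => _ /card_le_trans; apply.
have ex : exists m, `[< dispersed_size e d m >].
  exists 0%N; apply/asboolP; exists set0; first by split=> // ? [].
  by rewrite II0.
have : [set n | dispersed_size e d n /\
          forall m, dispersed_size e d m -> (m <= n)%N] (disp e d).
  apply: xgetPex; case: (ex_maxnP ex bnd) => n /asboolP nP nM.
  by exists n; split=> // m /asboolP; exact: nM.
move=> [dP dM]; split=> // S SP.
have /finite_setP[n Sn] : finite_set S.
  exact: card_le_finite (dispersed_card_le d0 SP) (finite_II _).
case/card_eqPle: Sn (Sn) => Sn _ Sn'; apply: card_le_trans Sn _.
by rewrite card_le_II dM//; exists S.
Qed.

End Dispersion.

(* Main.v *)
Require Import Defs.
From mathcomp Require Import all_boot all_order all_algebra.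
From mathcomp Require Import all_classical all_reals.
From mathcomp Require Import topology normedtype derive.
From mathcomp Require Import zify lra.
Set Implicit Arguments.
Unset Strict Implicit.
Unset Printing Implicit Defensive.
Import Order.TTheory GRing.Theory Num.Theory.
Import numFieldNormedType.Exports.
Local Open Scope ring_scope.

(* Keep every point of a delta-dispersed set on its edge and keep the order of
   the points on each edge: being r-dispersed is then a finite system of linear
   inequalities in the positions, each involving two points. Let r be the largest
   value in [delta, deltastar] for which this system is solvable. If
   r < deltastar, then some tight constraints chain up into an infinite walk in
   the graph meeting a point every r (or turning around at one); otherwise all
   tight constraints could be loosened simultaneously.

   Along such a walk, let the phase at a vertex w be the distance from the last
   point modulo r. If theta(w) is the distance from w to the nearest point, the
   phase is theta(w) or -theta(w), so two visits of w at times i < j have either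
   j - i = 0 or 2 c + i + j = 0 modulo r, where c is the initial phase. Taking the
   first repeated vertex, and then the first repetition after its first visit,
   yields a positive multiple of r that is an integer at most 2L + 2, because
   the vertices between repetitions form a path. So r is a candidate for
   deltastar, a contradiction. *)

(** * Repeated vertices and phases along walks *)

Lemma first_repeat (V : finType) (v : nat -> V) (a : nat) :
  exists m k, [/\ (a <= m < k)%N, v m = v k
    & forall x y, (a <= x)%N -> (x < y)%N -> (y < k)%N -> v x <> v y].
Proof.
pose P k := [exists m : 'I_k, (a <= m)%N && (v m == v k)].
have exP : exists k, P k.
  pose f (x : 'I_(#|V|.+1)) := v (a + x)%N.
  have /injectivePn[x [y xy fxy]] : ~~ injectiveb f.
    apply/injectiveP => /leq_card; rewrite card_ord ltnn//.
  wlog lt_xy : x y xy fxy / (x < y)%N.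
    move=> H; have [|lt_xy|eq_xy] := ltngtP x y; first exact: H.
    - by apply: (H y x) => //; rewrite eq_sym.
    - by move: xy; rewrite (ord_inj eq_xy) eqxx.
  have lt_axy : (a + x < a + y)%N by rewrite ltn_add2l.
  exists (a + y)%N; apply/existsP; exists (Ordinal lt_axy) => /=.
  by rewrite leq_addr; apply/eqP.
case: (ex_minnP exP) => k /existsP[m /andP[am /eqP vmk]] kmin.
exists m, k; split=> // [|x y ax xy yk vxy]; first by rewrite am /=.
have : P y by apply/existsP; exists (Ordinal xy); rewrite ax /= vxy.
by move/kmin; rewrite leqNgt yk.
Qed.

(** The vertices at times [a] to [k - 1] are distinct, so they form a path with [k - 1 - a]
    edges. *)
Lemma walk_bound (V : finType) (e : rel V) (L : nat) (v : nat -> V) (a k : nat) :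
  path_length_bound e L -> (forall n, e (v n) (v n.+1)) -> (a < k)%N ->
  (forall x y, (a <= x)%N -> (x < y)%N -> (y < k)%N -> v x <> v y) ->
  (k <= a + L.+1)%N.
Proof.
move=> eL ve ak vI; have := eL (v a) [seq v i | i <- iota a.+1 (k - a.+1)].
rewrite size_map size_iota; suff H : forall n b, path e (v b) [seq v i | i <- iota b.+1 n].
  move=> /(_ (H _ _)) H1.
  suff /H1 : uniq (v a :: [seq v i | i <- iota a.+1 (k - a.+1)]) by lia.
  rewrite -map_cons -[_ :: iota _ _]/(iota a (k - a.+1).+1) map_inj_in_uniq ?iota_uniq//.
  move=> x y; rewrite !mem_iota => hx hy vxy.
  have [xy|yx|//] := ltngtP x y.
    by case: (vI x y) => //; lia.
  by case: (vI y x) => //; lia.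
by elim=> [//|n IH] b /=; rewrite ve IH.
Qed.

Lemma eq_ratio (R : realType) (r : R) (a : nat) (z : int) :
  0 < r -> (0 < a)%N -> a%:R = z%:~R * r -> exists2 b, (0 < b)%N & r = a%:R / b%:R.
Proof.
move=> r0 a0 aE.
have z0 : (0 < z%:~R :> R) by rewrite -(pmulr_lgt0 _ r0) -aE ltr0n.
have zE : z%:~R = (`|z|%N)%:R :> R.
  by rewrite natr_absz ger0_norm// -(ler0z R) ltW.
exists `|z|%N; first by rewrite -(ltr0n R) -zE.
by rewrite aE -zE mulrAC divff ?mul1r// gt_eqF.
Qed.

(* The first repetition [v i = v j] of the walk and the first repetition
   [v m = v k] past [i] give either a multiple [j - i] or [k - m] of [r] (the
   two visits have the same phase), or two sums of opposite phases, whose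
   difference [(m + k) - (i + j)] is a multiple of [r]. *)
Lemma phase_ratio (R : realType) (V : finType) (e : rel V) (L : nat)
    (v : nat -> V) (theta : V -> R) (r c : R) :
  path_length_bound e L -> (forall n, e (v n) (v n.+1)) -> 0 < r ->
  (forall n, exists z : int, c + n%:R = theta (v n) + z%:~R * r \/
                             c + n%:R = - theta (v n) + z%:~R * r) ->
  exists a b, [/\ (0 < a <= 2 * L + 2)%N, (0 < b)%N & r = a%:R / b%:R].
Proof.
move=> eL ve r0 ph.
have conclude a z : (0 < a <= 2 * L + 2)%N -> a%:R = z%:~R * r ->
    exists a b, [/\ (0 < a <= 2 * L + 2)%N, (0 < b)%N & r = a%:R / b%:R].
  move=> /[dup] aL /andP[a0 _] /(eq_ratio r0 a0)[b b0 rE].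
  by exists a, b.
have revisit x y : (x < y <= x + L.+1)%N -> v x = v y ->
    (exists a b, [/\ (0 < a <= 2 * L + 2)%N, (0 < b)%N & r = a%:R / b%:R]) \/
    exists z : int, c + c + (x + y)%:R = z%:~R * r.
  move=> xyL vxy; have [zx hx] := ph x; have [zy hy] := ph y.
  rewrite -vxy in hy; case: hx hy => hx [] hy.
  - left; apply: (conclude (y - x)%N (zy - zx)); first lia.
    by rewrite natrB ?intrB; [lra|lia].
  - by right; exists (zx + zy); rewrite natrD intrD; lra.
  - by right; exists (zx + zy); rewrite natrD intrD; lra.
  - left; apply: (conclude (y - x)%N (zy - zx)); first lia.
    by rewrite natrB ?intrB; [lra|lia].
have [i [j [ij vij injj]]] := first_repeat v 0.
have [m [k [mk vmk injk]]] := first_repeat v i.+1.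
have jL := @walk_bound _ _ _ _ 0 j eL ve ltac:(lia) injj.
have kL := @walk_bound _ _ _ _ i.+1 k eL ve ltac:(lia) injk.
(* Otherwise [v m = v k] with [k < j], or [v m = v k = v j = v i] when [k = j]: a repetition before
   time [j]. *)
have jk : (j < k)%N.
  rewrite ltnNge leq_eqVlt; apply/negP => /orP[/eqP kj|kj].
    by apply: (injj i m); [lia|lia|lia|rewrite vij vmk kj].
  by apply: (injj m k) => //; lia.
have [//|[z1 h1]] := revisit i j ltac:(lia) vij.
have [//|[z2 h2]] := revisit m k ltac:(lia) vmk.
(* Positive since [i < m] and [j < k]; at most [2 * L + 2] since [m < k <= i + L + 2] and
   [i < j]. *)
apply: (conclude (m + k - (i + j))%N (z2 - z1)); first lia.
by rewrite natrB ?intrB; [lra|lia].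
Qed.

(** * Shortest-path distance between vertices *)

Definition graph_distance (V : finType) (e : rel V) (d : V -> V -> nat) : Prop :=
  forall u w, (exists p, [/\ path e u p, last u p = w & size p = d u w]) /\
              (forall p, path e u p -> last u p = w -> (d u w <= size p)%N).

Lemma graph_distance_exists (V : finType) (e : rel V) :
  (forall u v, connect e u v) -> exists d, graph_distance e d.
Proof.
move=> conn.
have H (x : V * V) : exists n : nat,
    (exists p, [/\ path e x.1 p, last x.1 p = x.2 & size p = n]) /\
    (forall p, path e x.1 p -> last x.1 p = x.2 -> (n <= size p)%N).
  pose P n := `[< exists p, [/\ path e x.1 p, last x.1 p = x.2 & size p = n] >].
  have exP : exists n, P n.
    have /connectP[p pP pl] := conn x.1 x.2.
    by exists (size p); apply/asboolP; exists p.
  case: (ex_minnP exP) => n /asboolP nP nmin; exists n; split=> // p pP pl.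
  by apply: nmin; apply/asboolP; exists p.
have [f fP] := choice H.
by exists (fun u w => f (u, w)) => u w; apply: (fP (u, w)).
Qed.

Section GraphDistance.
Context {V : finType} {e : rel V} {d : V -> V -> nat}.
Hypothesis dP : graph_distance e d.

Lemma gdist_path u w : exists p, [/\ path e u p, last u p = w & size p = d u w].
Proof. by case: (dP u w). Qed.

Lemma gdist_le u w p : path e u p -> last u p = w -> (d u w <= size p)%N.
Proof. by case: (dP u w) => _; apply. Qed.

Lemma gdistxx u : d u u = 0%N.
Proof. by apply/eqP; rewrite -leqn0; apply: (@gdist_le u u [::]). Qed.

Lemma gdist_edge u w : e u w -> (d u w <= 1)%N.
Proof. by move=> uw; apply: (@gdist_le u w [:: w]) => //=; rewrite uw. Qed.

Lemma gdist_triangle v u w : (d u w <= d u v + d v w)%N.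
Proof.
have [p [pP pl <-]] := gdist_path u v; have [q [qP ql <-]] := gdist_path v w.
by rewrite -size_cat; apply: gdist_le; rewrite ?cat_path ?last_cat ?pl ?pP.
Qed.

Lemma gdist_sym u w : symmetric e -> d u w = d w u.
Proof.
move=> e_sym; suff H a b : (d b a <= d a b)%N by apply/eqP; rewrite eqn_leq !H.
have [p [pP pl <-]] := gdist_path a b; rewrite -[leqRHS](size_belast a) -size_rev.
apply: gdist_le; first by rewrite -pl rev_path (@eq_path _ _ e) // => x y; apply: e_sym.
rewrite -pl; case/lastP: p {pP pl} => // p x.
by rewrite belast_rcons rev_cons last_rcons.
Qed.

(** The second vertex of a shortest walk from [v] to [w] works, by the triangle inequality. *)
Lemma gdist_step u w v : (d u v + d v w = d u w)%N -> v <> w ->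
  exists v', [/\ e v v', d u v' = (d u v).+1 & (d u v' + d v' w = d u w)%N].
Proof.
move=> uvw vw; have [[|v' p] [pP pl sp]] := gdist_path v w; first by case: vw.
case/andP: pP => vv' pP; exists v'; split=> //.
  have := gdist_triangle v' u w; have := gdist_triangle v u v'.
  have := gdist_edge vv'; have := @gdist_le v' w p pP pl.
  by move: sp => /=; lia.
have := gdist_triangle v' u w; have := gdist_triangle v u v'.
have := gdist_edge vv'; have := @gdist_le v' w p pP pl.
by move: sp => /=; lia.
Qed.

End GraphDistance.

(** * Distances between points on edges *)

Section EdgePoints.
Context {R : realType} {V : finType} (e : rel V).
Implicit Types (u v : V) (s t : R).

Lemma edgeptC u v t : edgept u v t = edgept v u (1 - t).
Proof. by apply/ffunP => w; rewrite !ffunE opprB addrCA subrr addr0 addrC. Qed.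

Lemma edgept0 u v : edgept u v 0 = edgept u u 0 :> {ffun V -> R}.
Proof. by apply/ffunP => w; rewrite !ffunE !mul0rn. Qed.

Lemma edgept1 u v : edgept u v 1 = edgept v v 0 :> {ffun V -> R}.
Proof. by rewrite edgeptC subrr edgept0. Qed.

(** Comparing the coordinates at the four ends leaves the same edge in one of its two orientations,
    or a vertex [z] common to both edges. *)
Lemma edgept_eq u v t u' v' t' : u <> v -> u' <> v' ->
  edgept u v t = edgept u' v' t' ->
  [\/ [/\ u = u', v = v' & t = t'], [/\ u = v', v = u' & t = 1 - t'] |
     exists2 z, u = z /\ t = 0 \/ v = z /\ t = 1 &
                u' = z /\ t' = 0 \/ v' = z /\ t' = 1].
Proof.
move=> /eqP uv /eqP uv' /ffunP E.
have vu : v != u by rewrite eq_sym. have vu' : v' != u' by rewrite eq_sym.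
have := (E u, E v, E u', E v'); rewrite !ffunE !eqxx.
rewrite (negbTE uv) (negbTE uv') (negbTE vu) (negbTE vu').
rewrite ![u == _]eq_sym ![v == _]eq_sym.
have [uu|nuu] := eqVneq u' u; [subst u'|have [uv1|nuv] := eqVneq u' v; [subst u'|]].
- rewrite ?(negbTE uv') ?(negbTE uv) ?(negbTE vu) ?(negbTE vu').
  have [<-|nvv] := eqVneq v' v; rewrite ?mulr1n ?mulr0n => -[[[h1 h2] h3] h4].
    by constructor 1; split=> //; lra.
  by constructor 3; exists u; left; split=> //; lra.
- rewrite ?(negbTE uv') ?(negbTE uv) ?(negbTE vu) ?(negbTE vu').
  have [<-|nvv] := eqVneq v' u; rewrite ?mulr1n ?mulr0n => -[[[h1 h2] h3] h4].
    by constructor 2; split=> //; lra.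
  by constructor 3; exists v; [right|left]; split=> //; lra.
- have [vu1|nvu] := eqVneq v' u; [subst v'|have [vv1|nvv] := eqVneq v' v; [subst v'|]];
    rewrite ?(negbTE uv) ?(negbTE vu) ?mulr1n ?mulr0n => -[[[h1 h2] h3] h4].
  + by constructor 3; exists u; [left|right]; split=> //; lra.
  + by constructor 3; exists v; right; split=> //; lra.
  + by exfalso; lra.
Qed.

Lemma route_walk u p q l : path e u p ->
  route e (edgept (last u p) (last u p) 0) q l ->
  route e (edgept u u 0) q ((size p)%:R + l : R).
Proof.
elim: p u => [|v p IH] u /=; first by rewrite add0r.
case/andP=> uv pP /(IH _ pP) rP.
rewrite -(edgept0 _ v) -natr1 addrAC addrC.
have E : `|0 - 1| = 1 :> R by rewrite sub0r normrN normr1.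
rewrite -[X in X + _]E.
apply: route_step => //; rewrite ?lexx ?ler01//.
by rewrite edgept1.
Qed.

Lemma route_through d u v t u' v' t' : graph_distance e d ->
  e u v -> e u' v' -> 0 <= t <= 1 -> 0 <= t' <= 1 ->
  route e (edgept u v t) (edgept u' v' t') (1 - t + (d v u')%:R + t').
Proof.
move=> dP uv uv' /[dup] ht /andP[t0 t1] /[dup] ht' /andP[t0' t1'].
have -> : 1 - t + (d v u')%:R + t' = `|t - 1| + ((d v u')%:R + (`|0 - t'| + 0)).
  by rewrite distrC ger0_norm ?subr_ge0// sub0r normrN ger0_norm// addr0 addrA.
apply: route_step => //; rewrite ?lexx ?ler01//.
have [p [pP pl <-]] := gdist_path dP v u'.
rewrite edgept1; apply: route_walk => //; rewrite pl -(edgept0 _ v').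
by apply: route_step; rewrite ?lexx ?ler01//; apply: route_refl; exists u', v', t'.
Qed.

Lemma dist_le_through d u v t u' v' t' : graph_distance e d ->
  e u v -> e u' v' -> 0 <= t <= 1 -> 0 <= t' <= 1 ->
  dist e (edgept u v t) (edgept u' v' t') <= 1 - t + (d v u')%:R + t'.
Proof.
move=> *; apply: ge_inf; last exact: route_through.
by exists 0 => l; apply: route_ge0.
Qed.

(** A potential argument: [c] is 1-Lipschitz along edges and at the ends of the target's edge does
    not exceed the distance to the target, so it bounds from below every route from a vertex. The
    last two bounds on [r] treat routes that stay on one edge. *)
Lemma route_ge (c : V -> R) u v s u' v' t l r : symmetric e -> irreflexive e ->
  (forall a b, e a b -> c a <= c b + 1) -> e u v -> e u' v' ->
  0 <= t <= 1 -> c u' <= t -> c v' <= 1 - t ->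
  r <= c u + s -> r <= c v + (1 - s) ->
  (u = u' -> v = v' -> r <= `|s - t|) ->
  (u = v' -> v = u' -> r <= `|1 - s - t|) ->
  route e (edgept u v s) (edgept u' v' t) l -> r <= l.
Proof.
move=> e_sym e_irr c_lip uv uv' ht cu cv ru rv r1 r2.
have neq a b : e a b -> a <> b by move=> /[swap] ->; rewrite e_irr.
(* The invariant for a route of length [m] from [x] to the target: either [x] lies on the target's
   edge within direct distance [m], or [x] can leave its edge through an end [a] at a cost allowed
   by [c]. *)
pose P x m := (exists s1, [/\ x = edgept u' v' s1, 0 <= s1 <= 1 & `|s1 - t| <= m]) \/
  (exists a b s1, [/\ e a b, x = edgept a b s1, 0 <= s1 <= 1 & c a + s1 <= m]).
have end_le z s1 m : `|s1 - t| <= m -> (u' = z /\ s1 = 0 \/ v' = z /\ s1 = 1) -> c z <= m.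
  move=> H [[<- s0]|[<- s0]]; apply: le_trans H; rewrite s0; case/andP: ht => t0 t1.
    by rewrite sub0r normrN ger0_norm.
  by rewrite ger0_norm// subr_ge0.
have cone_le z a b s1 m : e a b -> c a + s1 <= m ->
    (a = z /\ s1 = 0 \/ b = z /\ s1 = 1) -> c z <= m.
  move=> ab H [[<- s0]|[<- s0]]; apply: le_trans H; rewrite s0 ?addr0//.
  by apply: c_lip; rewrite e_sym.
have inv x y m : route e x y m -> y = edgept u' v' t -> P x m.
  elim=> {x y m} [x _ ->|a b s1 t1 q m ab hs1 ht1 _ IH qE].
    by left; exists t; rewrite subrr normr0.
  have tri (x y : R) : y <= m -> x <= y + `|s1 - t1| -> x <= `|s1 - t1| + m by lra.
  have hs1' : 0 <= 1 - s1 <= 1 by lra.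
  (* Where the route changes edges it is at a vertex [z], and only [c z <= m] is carried over. *)
  have vertex z : c z <= m -> (a = z /\ t1 = 0 \/ b = z /\ t1 = 1) ->
      P (edgept a b s1) (`|s1 - t1| + m).
    move=> zm [[az t10]|[bz t11]]; right.
      exists a, b, s1; split=> //; apply: tri zm _.
      by rewrite az lerD2l t10 subr0 ler_norm.
    exists b, a, (1 - s1); split=> //; rewrite ?(e_sym b)// ?(edgeptC a)//.
    by apply: tri zm _; rewrite bz lerD2l t11 distrC ler_norm.
  have [[s2 [yE hs2 s2m]]|[a2 [b2 [s2 [ab2 yE hs2 s2m]]]]] := IH qE.
    have [[aE bE tE]|[aE bE tE]|[z az uz]] := edgept_eq (neq _ _ ab) (neq _ _ uv') yE.
    - left; exists s1; rewrite aE bE; split=> //; apply: tri s2m _; rewrite tE [leRHS]addrC.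
      exact: ler_distD.
    - left; exists (1 - s1); rewrite aE bE edgeptC; split=> //; apply: tri s2m _.
      rewrite [leRHS]addrC (_ : s1 - t1 = - (1 - s1 - s2)); last lra.
      by rewrite normrN; apply: ler_distD.
    - by apply: vertex az; apply: end_le s2m uz.
  have [[aE bE tE]|[aE bE tE]|[z az uz]] := edgept_eq (neq _ _ ab) (neq _ _ ab2) yE.
  - right; exists a, b, s1; split=> //; apply: tri s2m _.
    by have := ler_norm (s1 - t1); rewrite aE tE; lra.
  - right; exists b, a, (1 - s1); split=> //; rewrite ?(e_sym b)// ?(edgeptC a)//.
    apply: tri s2m _; have := ler_norm (- (s1 - t1)).
    by rewrite normrN bE tE; lra.
  - by apply: vertex az; apply: cone_le ab2 s2m uz.
move=> /inv /(_ erefl).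
have vertex z : c z <= l -> (u = z /\ s = 0 \/ v = z /\ s = 1) -> r <= l.
  move=> zl [[uz s0]|[vz s1]]; apply: le_trans zl.
    by move: ru; rewrite -uz s0 addr0.
  by move: rv; rewrite -vz s1 subrr addr0.
case=> [[s1 [yE hs1 s1l]]|[a [b [s1 [ab yE hs1 s1l]]]]].
  have [[aE bE tE]|[aE bE tE]|[z az uz]] := edgept_eq (neq _ _ uv) (neq _ _ uv') yE.
  - by apply: le_trans s1l; rewrite -tE; apply: r1.
  - by apply: le_trans s1l; apply: (le_trans (r2 aE bE)); rewrite tE subKr.
  - by apply: vertex az; apply: end_le s1l uz.
have [[aE bE tE]|[aE bE tE]|[z az uz]] := edgept_eq (neq _ _ uv) (neq _ _ ab) yE.
- by apply: le_trans s1l; rewrite -tE -aE.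
- by apply: le_trans s1l; apply: (le_trans rv); rewrite tE bE; lra.
- by apply: vertex az; apply: cone_le ab s1l uz.
Qed.

Lemma dist_ge d u v s u' v' t r : symmetric e -> irreflexive e ->
  graph_distance e d -> e u v -> e u' v' -> 0 <= s <= 1 -> 0 <= t <= 1 ->
  r <= s + (d u u')%:R + t -> r <= s + (d u v')%:R + (1 - t) ->
  r <= 1 - s + (d v u')%:R + t -> r <= 1 - s + (d v v')%:R + (1 - t) ->
  (u = u' -> v = v' -> r <= `|s - t|) ->
  (u = v' -> v = u' -> r <= `|1 - s - t|) ->
  r <= dist e (edgept u v s) (edgept u' v' t).
Proof.
move=> e_sym e_irr dP uv uv' hs ht r1 r2 r3 r4 r5 r6.
apply: lb_le_inf; first by exists (1 - s + (d v u')%:R + t); apply: route_through.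
(* The potential enters the target's edge through the better of its two ends. *)
move=> l /=; pose c z : R := Num.min ((d z u')%:R + t) ((d z v')%:R + (1 - t)).
have dS a b w : e a b -> (d a w)%:R <= (d b w)%:R + 1 :> R.
  move=> ab; rewrite natr1 ler_nat (leq_trans (gdist_triangle dP b a w))//.
  by rewrite -add1n leq_add2r (gdist_edge dP).
apply: (@route_ge c u v s u' v' t) => //.
- move=> a b ab; rewrite /c addr_minl.
  have := dS a b u' ab; have := dS a b v' ab => h1 h2.
  by rewrite le_min !ge_min; apply/andP; split; apply/orP; [left|right]; lra.
- by rewrite /c ge_min (gdistxx dP) add0r lexx.
- by rewrite /c ge_min (gdistxx dP) add0r lexx orbT.
- by rewrite /c addr_minl le_min; apply/andP; split; lra.
- by rewrite /c addr_minl le_min; apply/andP; split; lra.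
Qed.

End EdgePoints.

Lemma finite_lower_bound (R : realType) (T : finType) (f : T -> R) :
  (forall x, 0 < f x) -> exists2 m, 0 < m & forall x, m <= f x.
Proof.
move=> f0; exists (\big[Num.min/1]_x f x); last by move=> x; apply: bigmin_le.
by apply: lt_bigmin.
Qed.

(** * Dispersion on fixed edges as a system of linear inequalities *)

Section Configurations.
Context {R : realType} {V : finType} (e : rel V) (d : V -> V -> nat).
Context {n : nat} (u v : 'I_n -> V) (t0 : 'I_n -> R).
Implicit Types (r : R) (t : 'I_n -> R).

(* The point [s.1] on its edge, with a direction of travel along that edge. *)
Let state := ('I_n * bool)%type.
Implicit Types s : state.

Definition tail s := if s.2 then u s.1 else v s.1.
Definition head s := if s.2 then v s.1 else u s.1.
Definition flip s : state := (s.1, ~~ s.2).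
Definition pos t s := if s.2 then t s.1 else 1 - t s.1.
(** The order is frozen at the initial positions [t0], so that [jump] is constant and [slack] is
    linear in the unknowns [r] and [t]. *)
Definition before s s' :=
  [&& tail s == tail s', head s == head s' & pos t0 s < pos t0 s'].
(* [jump s s' + pos t s' - pos t s] is the length of the way that leaves [s]
   forwards and arrives at [s'] forwards; for [s' = flip s] the way turns back
   at [head s] and the constraint [0 <= slack] says [pos t s <= 1]. *)
Definition jump s s' : nat := if before s s' then 0%N else (d (head s) (tail s')).+1.
Definition slack r t s s' :=
  (jump s s')%:R + pos t s' - pos t s - r * (s.1 != s'.1)%:R.
Definition feasible r t := forall s s', s != s' -> 0 <= slack r t s s'.
Definition tight r t s s' := (s != s') && (slack r t s s' == 0).

Hypotheses (e_sym : symmetric e) (e_irr : irreflexive e).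
Hypothesis dP : graph_distance e d.
Hypothesis uv : forall i, e (u i) (v i).

Lemma flipK : involutive flip.
Proof. by case=> i b; rewrite /flip negbK. Qed.

Lemma tail_flip s : tail (flip s) = head s.
Proof. by case: s => i []. Qed.

Lemma head_flip s : head (flip s) = tail s.
Proof. by case: s => i []. Qed.

Lemma pos_flip t s : pos t (flip s) = 1 - pos t s.
Proof. by case: s => i []; rewrite /pos //= subKr. Qed.

Lemma edge_state s : e (tail s) (head s).
Proof. by case: s => i []; rewrite /tail /head //= e_sym. Qed.

Lemma tail_neq_head s : tail s != head s.
Proof. by apply/eqP => h; have := edge_state s; rewrite h e_irr. Qed.

Lemma state_eq s s' : s.1 = s'.1 -> s != s' -> s' = flip s.
Proof. by case: s s' => i b [j c] /= <-; case: b c => [] []; rewrite ?eqxx. Qed.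

Lemma edgept_state t s : edgept (tail s) (head s) (pos t s) = edgept (u s.1) (v s.1) (t s.1).
Proof. by case: s => i []; rewrite /tail /head /pos //= -edgeptC. Qed.

Lemma before_neq s s' : before s s' -> s.1 != s'.1.
Proof.
case/and3P=> ts hs ps; apply/eqP => ss'.
have [sE|/(state_eq ss') sE] := eqVneq s s'; first by rewrite sE ltxx in ps.
by move: ts; rewrite sE tail_flip (negbTE (tail_neq_head _)).
Qed.

(** The same way travelled backwards. Hence tight pairs come with their reversals. *)
Lemma jump_flip s s' : jump (flip s') (flip s) = jump s s'.
Proof.
rewrite /jump /before !tail_flip !head_flip !pos_flip (gdist_sym dP _ _ e_sym).
by rewrite [head s' == _]eq_sym [tail s' == _]eq_sym ltrD2l ltrN2 andbCA.
Qed.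

Lemma slack_flip r t s s' : slack r t (flip s') (flip s) = slack r t s s'.
Proof.
rewrite /slack jump_flip !pos_flip [(flip s').1 == _]eq_sym.
by case: (_ != _); lra.
Qed.

Lemma feasible_pos r t s : feasible r t -> 0 <= pos t s <= 1.
Proof.
suff H s1 : feasible r t -> pos t s1 <= 1.
  by move=> F; rewrite H// andbT; have := H (flip s) F; rewrite pos_flip; lra.
move=> /(_ s1 (flip s1)); rewrite /slack /jump /before eqxx /= tail_flip.
rewrite (negbTE (tail_neq_head s1)) /= (gdistxx dP) pos_flip.
have -> : s1 != flip s1 by apply/eqP => /(congr1 snd) /=; case: s1.2.
by move=> /(_ isT); lra.
Qed.

(** Each way measured by a constraint between two different points is an actual route, hence no
    shorter than their distance. *)
Lemma dispersed_feasible r : (forall i, 0 <= t0 i <= 1) ->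
  (forall i j, i != j ->
    r <= dist e (edgept (u i) (v i) (t0 i)) (edgept (u j) (v j) (t0 j))) ->
  feasible r t0.
Proof.
move=> t01 rd s s' ss'.
have p01 s1 : 0 <= pos t0 s1 <= 1.
  by case: s1 => i []; rewrite /pos /=; have := t01 i; lra.
rewrite /slack; have [ii|ii] := eqVneq s.1 s'.1.
  rewrite (state_eq ii ss') /jump /before tail_flip (negbTE (tail_neq_head s)) /=.
  by rewrite (gdistxx dP) pos_flip; have := p01 s; lra.
have := rd _ _ ii; rewrite -!edgept_state mulr1 /jump.
case: ifPn => [/and3P[/eqP tt /eqP hh pp]|_] rE.
  have := le_trans rE; rewrite tt hh.
  move=> /(_ _ (dist_edge (edge_state s') (p01 s) (p01 s'))).
  by rewrite distrC gtr0_norm ?subr_gt0//; lra.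
have := le_trans rE (dist_le_through dP (edge_state s) (edge_state s') (p01 s) (p01 s')).
by rewrite -natr1; lra.
Qed.

(** A shortest route uses one end of each edge or stays on a common edge, and the constraints bound
    each case. On a common edge, distinctness at [t0] makes one of the points [before] the other. *)
Lemma feasible_dispersed r t i j : feasible r t -> i != j ->
  edgept (u i) (v i) (t0 i) <> edgept (u j) (v j) (t0 j) ->
  r <= dist e (edgept (u i) (v i) (t i)) (edgept (u j) (v j) (t j)).
Proof.
move=> F ij neq0.
have through s s' : s.1 = i -> s'.1 = j ->
    r <= 1 - pos t s + (d (head s) (tail s'))%:R + pos t s'.
  move=> si sj; have ss' : s != s' by apply: contra_neq ij => E; rewrite -si -sj E.
  have := F _ _ ss'; rewrite /slack si sj ij mulr1 /jump.
  case: ifP => _; last by rewrite -natr1; lra.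
  by have := feasible_pos s F; have := ler0n R (d (head s) (tail s')); lra.
have aligned s s' : s.1 = i -> s'.1 = j -> tail s = tail s' -> head s = head s' ->
    r <= `|pos t s - pos t s'|.
  move=> si sj tt hh.
  have ss' : s != s' by apply: contra_neq ij => E; rewrite -si -sj E.
  have s's : s' != s by rewrite eq_sym.
  have [lt|lt|eq] := ltgtP (pos t0 s) (pos t0 s').
  - have := F _ _ ss'; rewrite /slack si sj ij mulr1 /jump /before tt hh !eqxx lt /=.
    by have := ler_norm (- (pos t s - pos t s')); rewrite normrN; lra.
  - have := F _ _ s's; rewrite /slack si sj eq_sym ij mulr1 /jump /before tt hh !eqxx lt /=.
    by have := ler_norm (pos t s - pos t s'); lra.
  - by case: neq0; rewrite -si -sj -!(edgept_state t0) tt hh eq.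
have pi := feasible_pos (i, true) F; have pj := feasible_pos (j, true) F.
apply: (@dist_ge _ _ _ d) => //.
- by have := through (i, false) (j, true) erefl erefl; rewrite /pos /head /tail /= subKr.
- by have := through (i, false) (j, false) erefl erefl; rewrite /pos /head /tail /= subKr.
- exact: through (i, true) (j, true) erefl erefl.
- exact: through (i, true) (j, false) erefl erefl.
- exact: aligned (i, true) (j, true) erefl erefl.
- by move=> E1 E2; apply: (aligned (i, false) (j, true) erefl erefl).
Qed.

(** * Increasing [r], and its largest feasible value *)

Lemma feasible_improve r t rmax : r < rmax -> feasible r t ->
  (forall s s', tight r t s s' -> ~~ connect (tight r t) s' s) ->
  exists r' t', [/\ r < r', r' <= rmax & feasible r' t'].
Proof.
(* Moving [s] with velocity [X s = h (flip s) - h s] is consistent with flips,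
   and opens every tight pair since [h] decreases along tight pairs. *)
move=> r_lt F acyclic; pose h s := #|connect (tight r t) s|.
have h_lt s s' : tight r t s s' -> (h s' < h s)%N.
  move=> ss'; apply/proper_card/properP; split; last first.
    by exists s; rewrite !inE ?connect0//; apply: acyclic.
  by apply/fintype.subsetP => x; rewrite !inE; apply/connect_trans/connect1.
pose X s : R := (h (flip s))%:R - (h s)%:R.
(* The pair and its reversal each contribute a drop of [h] by at least one. *)
have X_tight s s' : tight r t s s' -> 2 <= X s' - X s.
  move=> ss'; have ss1 : tight r t (flip s') (flip s).
    rewrite /tight slack_flip (can_eq flipK) eq_sym; exact: ss'.
  have := h_lt _ _ ss'; have := h_lt _ _ ss1.
  by rewrite -!(ler_nat R) -!natr1 /X; lra.
(* [K] bounds the rate at which any slack can shrink: velocities differ by at most [K - 1], and the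
   growth of [r] adds at most 1. *)
pose K : R := #|{: state}|%:R * 2 + 1.
have K0 : 0 < K by rewrite ltr_wpDl// mulr_ge0.
have XK s s' : X s - X s' <= K - 1.
  have H s1 : 0 <= (h s1)%:R :> R /\ (h s1)%:R <= #|{: state}|%:R :> R.
    by rewrite ler0n ler_nat max_card.
  by rewrite /X /K; have := H s; have := H s'; have := H (flip s); have := H (flip s'); lra.
(* [m] is a positive lower bound for all positive slacks; the value 1 is a placeholder for the other
   pairs. *)
have [x|m m0 mP] := @finite_lower_bound R (state * state)%type
  (fun x => if 0 < slack r t x.1 x.2 then slack r t x.1 x.2 else 1).
  by case: ifPn.
pose eps := Num.min (m / K) (rmax - r).
have eps0 : 0 < eps by rewrite lt_min divr_gt0//= subr_gt0.
have epsK : eps * K <= m by rewrite -ler_pdivlMr// ge_min lexx.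
exists (r + eps), (fun i => t i + eps * X (i, true)); split.
- by rewrite ltrDl.
- by rewrite -lerBrDl ge_min lexx orbT.
have pE s : pos (fun i => t i + eps * X (i, true)) s = pos t s + eps * X s.
  by case: s => i []; rewrite /pos//= /X /flip /=; lra.
move=> s s' ss'; have := F _ _ ss'; set c : R := (s.1 != s'.1)%:R.
have c01 : 0 <= c <= 1 by rewrite /c; case: (_ != _); rewrite ?lexx ?ler01.
rewrite /slack !pE -/c => slack0.
have -> : (jump s s')%:R + (pos t s' + eps * X s') - (pos t s + eps * X s) - (r + eps) * c =
    slack r t s s' + eps * (X s' - X s - c) by rewrite /slack -/c; lra.
have [ts|nts] := boolP (tight r t s s').
  case/andP: (ts) => _ /eqP ->; rewrite add0r mulr_ge0 ?ltW//.
  by have := X_tight _ _ ts; lra.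
have s_gt0 : 0 < slack r t s s'.
  by rewrite lt_neqAle eq_sym F// andbT; move: nts; rewrite /tight ss'.
have := mP (s, s'); rewrite /= s_gt0; have : eps * (X s - X s' + c) <= eps * K.
  by rewrite ler_pM2l//; have := XK s s'; lra.
by lra.
Qed.

(** The constraints are closed and confine the positions to [[0, 1]], so the feasible pairs of [r]
    and [t] with [r] in [[r1, rmax]] form a compact set, on which [r] attains its maximum. *)
Lemma feasible_max r1 rmax : r1 <= rmax -> (exists t, feasible r1 t) ->
  exists r t, [/\ r1 <= r <= rmax, feasible r t &
    forall r' t', r' <= rmax -> feasible r' t' -> r' <= r].
Proof.
move=> r1_le [t1 F1].
(* Coordinate 0 holds [r], the other [n] hold the positions. *)
pose rad (x : 'rV[R]_n.+1) := x ord0 ord0.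
pose cfg (x : 'rV[R]_n.+1) (i : 'I_n) := x ord0 (lift ord0 i).
pose B (k : 'I_n.+1) : set R :=
  if unlift ord0 k is Some _ then `[0, 1]%classic else `[r1, rmax]%classic.
pose box := [set x : 'rV[R]_n.+1 | forall k, B k (x ord0 k)]%classic.
pose A := (box `&` [set x | feasible (rad x) (cfg x)])%classic.
have boxP x : box x <-> r1 <= rad x <= rmax /\ forall i, 0 <= cfg x i <= 1.
  split=> [bx|[bx0 bx1] k].
    split; first by have := bx ord0; rewrite /B unlift_none /= in_itv.
    by move=> i; have := bx (lift ord0 i); rewrite /B liftK /= in_itv.
  rewrite /B; case: unliftP => [i ->|->] /=; rewrite in_itv; first exact: bx1.
  exact: bx0.
have coordc k : continuous (fun x : 'rV[R]_n.+1 => x ord0 k).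
  by move=> x; apply: coord_continuous.
have subc (f g : 'rV[R]_n.+1 -> R) :
    continuous f -> continuous g -> continuous (fun x => f x - g x).
  by move=> fc gc x; exact: (cvgB (fc x) (gc x)).
have posc s : continuous (fun x => pos (cfg x) s).
  case: s => i []; rewrite /pos /=; first exact: coordc.
  by apply: (subc (fun=> 1) (fun x => cfg x i)); [exact: cst_continuous|exact: coordc].
have slackc s s' : continuous (fun x => slack (rad x) (cfg x) s s').
  apply: (subc (fun x => (jump s s')%:R + pos (cfg x) s' - pos (cfg x) s)
    (fun x => rad x * (s.1 != s'.1)%:R)); last first.
    have cc : continuous ((fun=> (s.1 != s'.1)%:R) : 'rV[R]_n.+1 -> R).
      exact: cst_continuous.
    by move=> x; exact: (cvgM (coordc ord0 x) (cc x)).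
  apply: (subc (fun x => (jump s s')%:R + pos (cfg x) s')); last exact: posc.
  have cc : continuous ((fun=> (jump s s')%:R) : 'rV[R]_n.+1 -> R) by exact: cst_continuous.
  by move=> x; exact: (cvgD (cc x) (posc s' x)).
have Ac : compact A.
  apply: compact_closedI.
    apply: rV_compact => k; rewrite /B; case: unlift => *; exact: segment_compact.
  rewrite (_ : mkset _ = \bigcap_(p in [set p : state * state | p.1 != p.2])
    ((fun x => slack (rad x) (cfg x) p.1 p.2) @^-1` [set y | 0 <= y]))%classic; last first.
    apply/seteqP; split=> x /= H; first by move=> p; apply: H.
    by move=> s s' ss'; apply: (H (s, s')).
  apply: closed_bigI => p _; apply: preimage_closed; last exact: closed_ge.
  by move=> x _; apply: slackc.
have embed r' t' : r1 <= r' <= rmax -> feasible r' t' -> exists2 y, A y & rad y = r'.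
  move=> r'P F'; pose y : 'rV[R]_n.+1 := \row_k if unlift ord0 k is Some i then t' i else r'.
  have radE : rad y = r' by rewrite /rad mxE unlift_none.
  have cfgE : cfg y = t' by apply/funext => i; rewrite /cfg mxE liftK.
  exists y => //; split; last by rewrite /= radE cfgE.
  apply/boxP; rewrite radE cfgE; split=> // i.
  exact: (feasible_pos (i, true) F').
have A0 : (A !=set0)%classic.
  by have [|y Ay _] := embed r1 t1 _ F1; [rewrite lexx r1_le|exists y].
have [|x /set_mem[/boxP[xr _] Fx] xmax] := @EVT_max_rV R _ rad A A0 Ac.
  by apply: continuous_subspaceT; apply: coordc.
exists (rad x), (cfg x); split=> // r' t' r'_le F'.
have [r'_lt|r1_le'] := ltP r' r1; first by apply: (le_trans (ltW r'_lt)); case/andP: xr.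
have [|y Ay <-] := embed r' t' _ F'; first by rewrite r1_le'.
by apply: xmax; apply/mem_set.
Qed.

(** * Phases at vertices and the walk along tight pairs *)

Definition reach t s w : R := 1 - pos t s + (d (head s) w)%:R.

(** This is theta. As [reach] leaves an edge through [head s] only, the minimum runs over both
    directions; its initial value is one of its terms. *)
Definition nearest t s0 w : R := \big[Num.min/reach t s0 w]_s reach t s w.

Lemma nearestP t s0 w s : (forall s', reach t s w <= reach t s' w) ->
  nearest t s0 w = reach t s w.
Proof.
move=> smin; apply/le_anti/andP; split; first exact: bigmin_le.
by apply: le_bigmin => *; apply: smin.
Qed.

Lemma reach_ge0 r t s w : feasible r t -> 0 <= reach t s w.
Proof. by move=> /(feasible_pos s); have := ler0n R (d (head s) w); rewrite /reach; lra. Qed.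

(** Going from [s] to [w] and then back along the way from [s'] is at least as long as the way in
    the constraint for [s] and [flip s']. *)
Lemma reach_add_ge r t s s' w : feasible r t -> s.1 != s'.1 ->
  r <= reach t s w + reach t s' w.
Proof.
move=> F ss'; have := F s (flip s'); have -> : s != flip s' by apply: contra_neq ss' => ->.
rewrite /slack ss' mulr1 pos_flip /reach => /(_ isT).
have : (jump s (flip s') <= (d (head s) w + d (head s') w).+1)%N.
  rewrite /jump; case: ifP => // _; rewrite ltnS tail_flip.
  by rewrite (leq_trans (gdist_triangle dP w _ _))// [d w _](gdist_sym dP _ _ e_sym).
by rewrite -(ler_nat R) -natr1 natrD; lra.
Qed.

Section TightWalk.
Variables (r : R) (t : 'I_n -> R) (s0 : state).
Hypotheses (r_gt0 : 0 < r) (F : feasible r t).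

(* The walk along infinitely many consecutive tight pairs passes through the
   vertex [w], at distance [y] after the last dispersed point. *)
Definition passes w y := exists s s',
  [/\ tight r t s s', connect (tight r t) s' s0, ~~ before s s',
      (d (head s) w + d w (tail s') = d (head s) (tail s'))%N & y = reach t s w].

Lemma tight_through s s' w : tight r t s s' -> ~~ before s s' ->
  (d (head s) w + d w (tail s') = d (head s) (tail s'))%N ->
  reach t s w + reach t (flip s') w = r * (s.1 != s'.1)%:R.
Proof.
case/andP=> _ /eqP + /negbTE nb wE; rewrite /slack /jump nb -wE /reach pos_flip head_flip.
by rewrite [d (tail s') w](gdist_sym dP _ _ e_sym) -natr1 natrD; lra.
Qed.

(** Between two different points, [w] splits a way of length exactly [r]. By [reach_add_ge] no point
    is closer to [w] than both ends of that way, so theta is [y] or [r - y]. At a turn the way has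
    length 0 and both are 0. *)
Lemma passes_phase w y : passes w y ->
  exists z : int, y = nearest t s0 w + z%:~R * r \/ y = - nearest t s0 w + z%:~R * r.
Proof.
case=> s [s' [/[dup] /andP[ss' _] ts _ nb wE ->]].
have := tight_through ts nb wE; have := reach_ge0 s w F; have := reach_ge0 (flip s') w F.
have [ii|ii] := eqVneq s.1 s'.1; rewrite ?mulr1 ?mulr0 => h1 h2 h3.
  exists 0; left; rewrite mul0r addr0 (@nearestP _ _ _ s)// => s1.
  by have := reach_ge0 s1 w F; lra.
have apart s1 : r <= reach t s1 w + reach t s w \/ r <= reach t s1 w + reach t (flip s') w.
  have [s1E|ns1] := eqVneq s1.1 s.1; [right|left]; apply: reach_add_ge => //.
  by rewrite s1E.
have [le|/ltW le] := leP (reach t s w) (reach t (flip s') w).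
  exists 0; left; rewrite mul0r addr0 (@nearestP _ _ _ s)// => s1.
  by case: (apart s1); lra.
exists 1; right; rewrite mul1r (@nearestP _ _ _ (flip s')); first lra.
by move=> s1; case: (apart s1); lra.
Qed.

Hypothesis cycle0 : exists2 s1, tight r t s0 s1 & connect (tight r t) s1 s0.

Lemma tight_next s : connect (tight r t) s s0 ->
  exists2 s', tight r t s s' & connect (tight r t) s' s0.
Proof.
case/connectP=> -[|s' p] /=; first by move=> _ <-.
by case/andP=> ss' pP ->; exists s' => //; apply/connectP; exists p.
Qed.

(** Tight pairs with [before] advance by [r] within the edge, so only finitely many follow one
    another; [k] counts these points between [s] and [head s]. *)
Lemma passes_head s : connect (tight r t) s s0 ->
  exists k : nat, passes (head s) (1 - pos t s - k%:R * r).
Proof.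
have [N] : exists N : nat, 1 - pos t s < N%:R * r.
  have /andP[_ p1] := feasible_pos s F.
  exists (Num.bound ((1 - pos t s) / r)); rewrite -ltr_pdivrMr//.
  by apply: archi_boundP; rewrite divr_ge0 ?subr_ge0// ltW.
elim: N s => [|N IH] s sN cs; first by have := feasible_pos s F; lra.
have [s' ts cs'] := tight_next cs.
have [b|nb] := boolP (before s s'); last first.
  exists 0%N, s, s'; split=> //; first by rewrite (gdistxx dP).
  by rewrite /reach (gdistxx dP) mul0r addr0 subr0.
have := before_neq b; have /and3P[_ /eqP hh _] := b.
case/andP: ts => _ /eqP; rewrite /slack /jump b => + ii; rewrite ii mulr1 => E.
have [|k kP] := IH s' _ cs'; first by rewrite -natr1 in sN; lra.
exists k.+1; rewrite hh; move: kP; congr passes.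
by rewrite -natr1; lra.
Qed.

(** Before reaching [tail s'] the walk takes one more edge of a shortest walk. At [tail s'] it
    crosses the edge of [s'], and [z] counts the points met there; a turn contributes none, since
    its two states share one point. *)
Lemma passes_next w y : passes w y ->
  exists w' y', [/\ e w w', passes w' y' & exists z : int, y' = y + 1 - z%:~R * r].
Proof.
case=> s [s' [ts cs nb wE ->]].
have [wt|/eqP wt] := eqVneq w (tail s').
  have [k kP] := passes_head cs; have := tight_through ts nb wE.
  rewrite /reach head_flip pos_flip -wt (gdistxx dP) => E.
  exists (head s'), (1 - pos t s' - k%:R * r); split=> //; first by rewrite wt edge_state.
  exists ((s.1 != s'.1)%:Z + k%:Z); rewrite intrD -!pmulrn; lra.
have [w' [ww' dw' wE']] := gdist_step dP wE wt.
exists w', (reach t s w'); split=> //; first by exists s, s'.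
by exists 0; rewrite mul0r subr0 /reach dw' -natr1 addrA.
Qed.

Lemma tight_cycle_ratio L : path_length_bound e L ->
  exists a b, [/\ (0 < a <= 2 * L + 2)%N, (0 < b)%N & r = a%:R / b%:R].
Proof.
move=> eL.
have next (x : V * R) : exists x' : V * R, passes x.1 x.2 ->
    [/\ e x.1 x'.1, passes x'.1 x'.2 & exists z : int, x'.2 = x.2 + 1 - z%:~R * r].
  have [/passes_next[w' [y' H]]|nx] := pselect (passes x.1 x.2); last by exists x.
  by exists (w', y').
have [f fP] := choice next.
have [k p0] := passes_head (connect0 (tight r t) s0).
pose x m := iter m f (head s0, 1 - pos t s0 - k%:R * r).
have xP m : passes (x m).1 (x m).2.
  by elim: m => [//|m IH]; have [] := fP _ IH.
apply: (@phase_ratio _ _ e L (fun m => (x m).1) (nearest t s0) r (x 0%N).2) => //.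
  by move=> m; have [] := fP _ (xP m).
(* Each edge adds 1 to the distance since the last point, modulo [r]. *)
move=> m; have [z zE] : exists z : int, (x 0%N).2 + m%:R = (x m).2 + z%:~R * r.
  elim: m => [|m [z zE]]; first by exists 0; rewrite mul0r !addr0.
  have [_ _ [z' z'E]] := fP _ (xP m); exists (z + z').
  by rewrite -natr1 addrA zE -[x m.+1]/(f (x m)) z'E intrD; lra.
have [z' [H|H]] := passes_phase (xP m); exists (z' + z); [left|right];
  by rewrite zE H intrD; lra.
Qed.

End TightWalk.

Lemma feasible_rounding L delta deltastar : 0 < delta -> path_length_bound e L ->
  rounding L delta deltastar -> (exists t, feasible delta t) ->
  exists t, feasible deltastar t.
Proof.
move=> delta0 eL [[_ [_ [_ _ _ le_star]]] star_min] /(feasible_max le_star).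
case=> r [t [/andP[r_ge r_le] F rmax]].
have [<-|r_neq] := eqVneq r deltastar; first by exists t.
have r_lt : r < deltastar by rewrite lt_neqAle r_neq.
have r0 : 0 < r := lt_le_trans delta0 r_ge.
(* A tight cycle makes [r] a candidate below [deltastar]; without one, [r] could still grow. *)
have [[s0 [s1 [ts cs]]]|acyclic] :=
    pselect (exists s0 s1, tight r t s0 s1 /\ connect (tight r t) s1 s0).
  have cyc : exists2 s1, tight r t s0 s1 & connect (tight r t) s1 s0 by exists s1.
  have [a [b [aL b0 rE]]] := tight_cycle_ratio r0 F cyc eL.
  by have := star_min r; rewrite leNgt r_lt => /(_ ltac:(by exists a, b)).
have [|r' [t' [lt_r' r'_le F']]] := feasible_improve r_lt F.
  by move=> s s' ss'; apply/negP => cs; apply: acyclic; exists s, s'.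
by have := rmax _ _ r'_le F'; rewrite leNgt lt_r'.
Qed.

End Configurations.

(** * Transfer between dispersed sets and configurations *)

Lemma dispersed_le (R : realType) (V : finType) (e : rel V) (d1 d2 : R) S :
  d1 <= d2 -> dispersed e d2 S -> dispersed e d1 S.
Proof. by move=> le_d [SV Sd]; split=> // p q Sp Sq pq; apply: le_trans (Sd _ _ Sp Sq pq). Qed.

Theorem theorem7 (R : realType) (V : finType) (e : rel V) (delta : R)
    (L : nat) (deltastar : R) :
  is_graph e -> 0 < delta -> path_length_bound e L ->
  rounding L delta deltastar ->
  disp e delta = disp e deltastar.
Proof.
move=> [e_sym e_irr conn _] delta0 eL rnd.
have le_star : delta <= deltastar by case: rnd => [[_ [_ [_ _ _ le]]] _].
have star0 := lt_le_trans delta0 le_star.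
have [[S Sdisp Scard] Smax] := dispP e delta0.
have [[S' S'disp S'card] S'max] := dispP e star0.
apply/eqP; rewrite eqn_leq; apply/andP; split; last first.
  rewrite -card_le_II; move/card_eqPle: S'card => [_] /card_le_trans; apply.
  exact: Smax (dispersed_le le_star S'disp).
have [d dP] := graph_distance_exists conn.
set n := disp e delta in Scard *.
(* An optimal set for [delta] is enumerated by ['I_n], and each of its points gets a chosen edge and
   position. *)
have /card_set_bijP[h [_ _ hsurj]] := Scard.
have inv (i : 'I_n) : exists p, S p /\ h p = i.
  by have [p Sp hp] := hsurj i (ltn_ord i); exists p.
have [g gP] := choice inv.
have Sg i : S (g i) by case: (gP i).
have gI i j : i != j -> g i <> g j.
  move=> /eqP ij gij; apply: ij; apply: val_inj.
  by have [_ hi] := gP i; have [_ hj] := gP j; rewrite /= -hi -hj gij.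
have [SV Sd] := Sdisp.
have rep (i : 'I_n) : exists x : V * V * R,
    [/\ e x.1.1 x.1.2, 0 <= x.2 <= 1 & g i = edgept x.1.1 x.1.2 x.2].
  by have [u [v [t H]]] := SV _ (Sg i); exists (u, v, t).
have [f fP] := choice rep.
pose u i := (f i).1.1; pose v i := (f i).1.2; pose t0 i := (f i).2.
have uv i : e (u i) (v i) by have [] := fP i.
have gE i : edgept (u i) (v i) (t0 i) = g i by have [_ _ ->] := fP i.
have [t F] : exists t, feasible d u v t0 deltastar t.
  apply: (feasible_rounding e_sym e_irr dP uv delta0 eL rnd).
  exists t0; apply: (dispersed_feasible e_sym e_irr dP uv) => //.
    by move=> i; have [] := fP i.
  by move=> i j ij; rewrite !gE; apply: Sd => //; apply: gI.
pose p (i : 'I_n) := edgept (u i) (v i) (t i).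
have pd i j : i != j -> deltastar <= dist e (p i) (p j).
  move=> ij; apply: (feasible_dispersed e_sym e_irr dP uv F) => //.
  by rewrite !gE; apply: gI.
have t01 i : 0 <= t i <= 1 := feasible_pos e_sym e_irr dP uv (i, true) F.
have dist0 i : dist e (p i) (p i) <= 0.
  by have := dist_edge (uv i) (t01 i) (t01 i); rewrite subrr normr0.
(* Coinciding points would be at distance at most 0, below [deltastar]; so the moved set still has
   [n] points. *)
have pI : injective p.
  move=> i j pij; apply/eqP; apply: contraT => /pd; rewrite -pij leNgt.
  by rewrite (le_lt_trans (dist0 i)).
rewrite -card_le_II; apply: (card_le_trans _ (S'max (range p) _)).
  have /card_eqPle[_ leI] : (range p #= [set: 'I_n])%card by apply: inj_card_eq => i j _ _ /pI.
  by have /card_eqPle[leII _] := @card_II n; apply: card_le_trans leII leI.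
split=> [_ [i _ <-]|_ _ [i _ <-] [j _ <-] ij].
  by exists (u i), (v i), (t i).
by apply: pd; apply/eqP => E; apply: ij; rewrite E.
Qed.
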